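(* Let $\alpha,\beta>0$ be rationally independent real numbers, let $p,q$ be positive, coprime integers, and let $f:\mathbb{R}\to\mathbb{C}$ be a measurable function satisfying $$\sum_{k\in\mathbb{Z}} f(x-k\alpha)=p,\qquad \sum_{k\in\mathbb{Z}} f(x-k\beta)=q\qquad\text{for a.e. } x\in\mathbb{R},$$ where both series converge absolutely for a.e. $x$. Then $$\operatorname{mes}(\operatorname{supp} f)>\alpha+\beta-\min\Big\{\frac{\alpha}{q},\frac{\beta}{p}\Big\}.$$
   Context: Two positive real numbers $\alpha,\beta$ are rationally independent if $n\alpha+m\beta=0$ with $n,m\in\mathbb{Z}$ implies $n=m=0$ (equivalently, $\alpha/\beta$ is irrational). The support of a function $f$ is the set $\operatorname{supp} f=\{x: f(x)\ne 0\}$ (no closure is taken). $\operatorname{mes}$ denotes Lebesgue measure on $\mathbb{R}$. *)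

(* Defs.v *)
From HB Require Import structures.
From mathcomp Require Import all_boot all_order all_algebra finmap complex.
From mathcomp Require Import all_classical all_reals all_analysis.
From mathcomp.analysis.showcase Require summability.

Set Implicit Arguments.
Unset Strict Implicit.
Unset Printing Implicit Defensive.

Import Order.TTheory GRing.Theory Num.Theory.
Import numFieldNormedType.Exports.

Local Open Scope classical_set_scope.
Local Open Scope complex_scope.
Local Open Scope ring_scope.

Definition rationally_independent (R : realType) (a b : R) : Prop :=
  forall n m : int, n%:~R * a + m%:~R * b = 0 -> n = 0 /\ m = 0.

(* R with the sigma-algebra of Lebesgue measurable sets, which is the one on
   which completed_lebesgue_measure is defined (the default sigma-algebra on R
   is the Borel one). *)
Definition lebesgueType (R : realType) :=
  caratheodory_type (@wlength R idfun)^*%mu.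

(* The field R[i] carries no topology of its own; R[i]^o has the usual one,
   induced by the modulus. *)
Definition borelC (R : realType) := g_sigma_algebraType (@open (R[i]^o)).

Definition lebesgue_measurable_fun (R : realType) (f : R -> R[i]) : Prop :=
  measurable_fun [set: lebesgueType R] (f : lebesgueType R -> borelC R).

Definition supp (R : realType) (f : R -> R[i]) : set R := [set x | f x != 0].

Definition abs_convergent (R : realType) (u : int -> R[i]) : Prop :=
  (\esum_(k in [set: int]) (Normc.normc (u k))%:E < +oo)%E.

(* The sum over all integers is the limit of the finite sums along the net of
   finite subsets of int; an absolutely convergent series has the same sum in
   every order of summation. *)
Definition sums_to (R : realType) (u : int -> R[i]) (s : R[i]) : Prop :=
  @summability.partial_sum int R[i]^o u @ summability.totally --> (s : R[i]^o).

(* Main.v *)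
(* Regard the points of the support S as the edges of a bipartite graph whose
   vertices are the cosets of alpha Z and of beta Z.  Integration over S turns
   combinatorics of the connected components into measures, because mass sent
   along the countable group alpha Z + beta Z is conserved by Lebesgue measure.

   On a finite component, summing f over the edges by rows and by columns gives
   p (#alpha-vertices) = q (#beta-vertices), hence at least q, resp. p, of them;
   and #edges >= #vertices - 1.  On infinite components the edges have at least
   the measure of the vertices.  If t is the measure of the set of leftmost edges
   of finite components, and A, B the measures of the alpha- and beta-vertices
   lying in finite components, then mes S >= alpha + beta - t with q t <= A,
   p t <= B and p A = q B.  If A = alpha or B = beta, the infinite components are
   negligible, hence p alpha = q beta, against independence.  So A < alpha and
   B < beta, and t < min(alpha / q, beta / p). *)

Require Import Defs.
From HB Require Import structures.
From mathcomp Require Import all_boot all_order all_algebra finmap complex.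
From mathcomp Require Import all_classical all_reals all_analysis.
From mathcomp Require Import measurable_realfun.

Set Implicit Arguments.
Unset Strict Implicit.
Unset Printing Implicit Defensive.

Import Order.TTheory GRing.Theory Num.Theory.
Import numFieldNormedType.Exports.

Local Open Scope classical_set_scope.
Local Open Scope complex_scope.
Local Open Scope ring_scope.

(** * Bipartite graphs given by their edges and endpoints *)

Section bipartite_graph.
Variables (E I : choiceType) (c : bool -> E -> I).
Implicit Types (G : set E) (b : bool) (g h s e : E).

(** Walks go from edge to edge through shared endpoints. Endpoints of the two colours are never
    compared with each other, so both kinds of vertices can be named in the same type [I]. *)
Fixpoint walk G n g h : Prop :=
  if n is m.+1 then
    exists x, [/\ walk G m g x, G h & exists b, c b x = c b h]
  else G g /\ g = h.

Definition conn G g h := exists n, walk G n g h.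

Definition component G e := [set h | conn G e h].

(* What remains attached to the endpoint [c b e] once [e] is removed. *)
Definition side G b e :=
  [set h | exists s, [/\ s != e, c b s = c b e & conn (G `\ e) s h]].

Lemma conn_refl G g : G g -> conn G g g.
Proof. by move=> Gg; exists 0%N. Qed.

Lemma conn_meml G g h : conn G g h -> G g.
Proof. by case=> n; elim: n h => [h []//|n IHn h /= [x [/IHn]]]. Qed.

Lemma conn_memr G g h : conn G g h -> G h.
Proof. by case; case=> [[Gg <-]//|n /= [x []]]. Qed.

Lemma conn_rcons G g x h b : conn G g x -> G h -> c b x = c b h -> conn G g h.
Proof. by move=> [n gx] Gh xh; exists n.+1; exists x; split => //; exists b. Qed.

Lemma conn_trans G x g h : conn G g x -> conn G x h -> conn G g h.
Proof.
move=> gx [n]; elim: n h => [h [_ <-]//|n IHn h /= [y [/IHn gy Gh [b yh]]]].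
exact: conn_rcons yh.
Qed.

Lemma conn_sym G g h : conn G g h -> conn G h g.
Proof.
move=> [n]; elim: n h => [h [Gg <-]|n IHn h /= [x [/IHn xg Gh [b xh]]]].
  exact: conn_refl.
apply: (conn_trans _ xg).
exact: conn_rcons (conn_refl Gh) (conn_meml xg) (esym xh).
Qed.

Lemma component_eq G g h : conn G g h -> component G g = component G h.
Proof.
move=> gh; apply/seteqP; split=> x /=; last exact: conn_trans.
by apply: conn_trans; exact: conn_sym.
Qed.

(** Follow a walk from [e]: each new edge, unless it is [e] again, continues the side of its
    predecessor, or starts a side if the predecessor is [e]. *)
Lemma component_sides G e :
  component G e `<=` e |` (side G true e `|` side G false e).
Proof.
move=> h [n]; elim: n h => [h [_ <-]|n IHn h /= [x [/IHn ex Gh [b xh]]]].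
  by left.
have [->|he] := eqVneq h e; first by left.
have Gh' : (G `\ e) h by split => //; apply/eqP.
right; case: ex => [xe|[] [s [se cs sx]]].
- have sh : side G b e h.
    by exists h; split; [|rewrite -xh xe|exact: conn_refl].
  by case: b sh {xh} => sh; [left|right].
- by left; exists s; split => //; exact: conn_rcons xh.
- by right; exists s; split => //; exact: conn_rcons xh.
Qed.

Lemma infinite_side G b e : infinite_set (component G e) ->
  finite_set (side G b e) -> infinite_set (side G (~~ b) e).
Proof.
move=> infe fb fnb; apply: infe; apply: (sub_finite_set (@component_sides G e)).
rewrite !finite_setU; split; first exact: finite_set1.
by case: b fb fnb.
Qed.

(** Behind the vertex [c b e] lie only its finitely many other edges [s] and what is reached through
    their opposite endpoints. A walk avoiding [e] that returns to this vertex does so along another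
    of these edges, and the description restarts there. *)
Lemma finite_side G b e : finite_set [set s | G s /\ c b s = c b e] ->
  (forall s, G s -> s != e -> c b s = c b e -> finite_set (side G (~~ b) s)) ->
  finite_set (side G b e).
Proof.
move=> fin fins.
pose D := [set s | G s /\ c b s = c b e] `\ e.
have : finite_set (\bigcup_(s in D) (s |` side G (~~ b) s)).
  apply: bigcup_finite; first exact: finite_setD.
  move=> s [[Gs cs] /eqP se]; rewrite finite_setU.
  by split; [exact: finite_set1|exact: fins].
apply: sub_finite_set => z [s0 [s0e cs0 [n]]].
elim: n z => [z [[Gs0 _] <-]|n IHn z /= [x [/IHn [s Ds sx] [Gz /eqP ze] [b' xz]]]].
  by exists s0; [split => //; apply/eqP|left].
have [cz|cz] := eqVneq (c b z) (c b e).
  by exists z; [split => //; apply/eqP|left].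
have zs : z != s.
  by apply: contra_neq cz => ->; case: Ds => -[].
exists s => //; right; case: sx => [xs|[t [ts ct tx]]].
  have {}xs : x = s := xs.
  case: (eqVneq b' b) => [bb|bb].
    by case/eqP: cz; rewrite -bb -xz xs bb; case: Ds => -[].
  exists z; split => //; last by apply: conn_refl; split => //; apply/eqP.
  have -> : ~~ b = b' by case: (b) (b') bb => [] [].
  by rewrite -xz xs.
exists t; split => //; apply: conn_rcons tx _ xz; split => //; exact/eqP.
Qed.

(* In an infinite component, hand an edge entirely to an endpoint behind which
   only finitely many edges remain once it is removed, and split it in halves
   between its endpoints if there is no such endpoint.  [share G b e] is twice
   the part of [e] that its [b]-endpoint receives. *)
Definition share G b e : nat :=
  (`[< infinite_set (side G (~~ b) e) >] + `[< finite_set (side G b e) >])%N.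

Lemma share_sum G e : (share G true e + share G false e = 2)%N.
Proof.
rewrite /share /= !asbool_neg.
by case: asbool; case: asbool.
Qed.

(** If some incident edge has a finite [b]-side, its opposite side is infinite and its whole share
    of 2 goes to the vertex. Otherwise, by [finite_side], at least two incident edges have infinite
    opposite sides, and each gives at least 1. *)
Lemma share_vertex G b e : infinite_set (component G e) ->
  finite_set [set s | G s /\ c b s = c b e] -> G e ->
  (exists s, [/\ G s, c b s = c b e & (2 <= share G b s)%N]) \/
  (exists s t, [/\ G s /\ c b s = c b e, G t /\ c b t = c b e,
    s != t, (1 <= share G b s)%N & (1 <= share G b t)%N]).
Proof.
move=> infe fin Ge.
case: (pselect (exists s, [/\ G s, c b s = c b e & finite_set (side G b s)])).
  move=> [s [Gs cs fs]]; left; exists s; split => //.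
  rewrite /share (asboolT fs) asboolT//; apply: infinite_side => //.
  by rewrite (@component_eq G s e)//; apply: conn_rcons (conn_refl Gs) Ge cs.
move=> nfin; right.
(* Applied to [e] and then to the edge found, this yields two distinct edges. *)
have two y : G y -> c b y = c b e -> exists s, [/\ G s, c b s = c b e, s != y &
    infinite_set (side G (~~ b) s)].
  move=> Gy cy; apply: contrapT => nex; apply: nfin; exists y; split => //.
  apply: finite_side; first by rewrite cy.
  move=> s Gs sy cs; apply: contrapT => infs; apply: nex.
  by exists s; split => //; rewrite cs.
have [s [Gs cs _ infs]] := two e Ge erefl.
have [t [Gt ct ts inft]] := two s Gs cs.
exists s, t; split => //; first by rewrite eq_sym.
- by rewrite /share (asboolT infs).
- by rewrite /share (asboolT inft).
Qed.

Local Open Scope fset_scope.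

(** Grow the component from [e] by one adjacent edge at a time: every new edge shares an endpoint
    with an earlier one and so adds at most one vertex. *)
Lemma card_component_le G e : G e -> finite_set (component G e) ->
  (#|` [fset c true x | x in fset_set (component G e)]| +
   #|` [fset c false x | x in fset_set (component G e)]| <=
   #|` fset_set (component G e)| + 1)%N.
Proof.
move=> Ge finC; set C := fset_set _.
have CE x : (x \in C) = (x \in component G e) by rewrite in_fset_set.
have eC : e \in C by rewrite CE inE; exact: conn_refl.
(* A walk from [e] to a missing edge leaves [D] at some step, which gives the adjacent pair [x],
   [y]. *)
have step (D : {fset E}) : D `<=` C -> e \in D -> D != C ->
    exists x y b, [/\ x \in D, y \in C, y \notin D & c b x = c b y].
  move=> DC eD DneC.
  have /fsubsetPn[y] : ~~ (C `<=` D).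
    by apply: contra DneC => CD; rewrite eqEfsubset DC.
  rewrite CE inE => -[n]; elim: n y => [y [_ <-]|n IHn y /= [x [ex Gy [b xy]]]].
    by rewrite eD.
  move=> yD; have [xD|xD] := boolP (x \in D); last exact: IHn xD.
  exists x, y, b; split => //; rewrite CE inE.
  by exists n.+1; exists x; split => //; exists b.
have main k : (k < #|` C|)%N -> exists D : {fset E},
    [/\ D `<=` C, e \in D, #|` D| = k.+1 &
     (#|` [fset c true x | x in D]| + #|` [fset c false x | x in D]|
       <= #|` D| + 1)%N].
  elim: k => [_|k IHk kC].
    exists [fset e]; rewrite !imfset_fset1 !cardfs1 fset11; split => //.
    by apply/fsubsetP => x; rewrite inE => /eqP ->.
  have [D [DC eD Dk Dle]] := IHk (ltnW kC).
  have [x [y [b [xD yC yD xy]]]] : exists x y b,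
      [/\ x \in D, y \in C, y \notin D & c b x = c b y].
    by apply: step => //; apply: contraTneq kC => <-; rewrite Dk ltnn.
  exists (y |` D); rewrite !imfsetU !imfset_fset1 cardfsU1 yD Dk.
  split => //; last 1 first.
  (* The shared colour [b] is put first: on that side the new edge brings no vertex. *)
  - have -> : (#|` [fset c true y] `|` [fset c true x0 | x0 in D]| +
          #|` [fset c false y] `|` [fset c false x0 | x0 in D]| =
         #|` c b y |` [fset c b x0 | x0 in D]| +
          #|` c (~~ b) y |` [fset c (~~ b) x0 | x0 in D]|)%N.
      by case: (b) => //=; rewrite addnC.
    rewrite !cardfsU1.
    have -> : c b y \in [fset c b x0 | x0 in D].
      by rewrite -xy; apply/imfsetP; exists x.
    have := Dle; rewrite Dk.
    have -> : (#|` [fset c true x0 | x0 in D]| +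
        #|` [fset c false x0 | x0 in D]| = #|` [fset c b x0 | x0 in D]| +
         #|` [fset c (~~ b) x0 | x0 in D]|)%N.
      by case: (b) => //=; rewrite addnC.
    by move=> Dle'; rewrite add0n addnCA -addnA leq_add// leq_b1.
  - by apply/fsubsetP => z; rewrite !inE => /predU1P[->//|/(fsubsetP DC)].
  - by rewrite !inE eD orbT.
have C0 : (0 < #|` C|)%N by rewrite cardfs_gt0; apply/fset0Pn; exists e.
have [|D [DC _ Dk Dle]] := main #|` C|.-1; first by rewrite prednK.
rewrite prednK// in Dk.
have -> : C = D by apply/esym/eqP; rewrite eqEfcard DC Dk leqnn.
exact: Dle.
Qed.

(** The edges are grouped by their [b]-endpoint. With [phi] given by $f$, the hypothesis on rows is
    the condition on the periodic sums. *)
Lemma component_vertex_sum (W : zmodType) (phi : E -> W) (a : W) G b e :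
  finite_set (component G e) ->
  (forall g, component G e g ->
    \sum_(h <- fset_set (component G e) | c b h == c b g) phi h = a) ->
  \sum_(h <- fset_set (component G e)) phi h =
    a *+ #|` [fset c b x | x in fset_set (component G e)]|.
Proof.
move=> finC rowsum; set C := fset_set _ in rowsum *.
rewrite (partition_big_imfset _ (c b)) /=.
rewrite big_seq_cond (eq_bigr (fun=> a)).
  by rewrite -big_seq_cond big_const_seq count_predT iter_addr_0 .
move=> i; rewrite andbT => /imfsetP[g /= gC ->].
by apply: rowsum; move: gC; rewrite in_fset_set// inE.
Qed.

End bipartite_graph.

(** * Mass transport *)

Section translation.
Variables (R : realType).
Local Notation mu := (@lebesgue_measure R).
Implicit Types (A : set R) (f : R -> \bar R).
Local Open Scope ereal_scope.

Lemma measurable_translation (t : R) :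
  measurable_fun [set: R] (fun x : R => (x + t)%R).
Proof. by apply: measurable_funD => //; exact: measurable_cst. Qed.

Lemma measurable_translate (t : R) A : measurable A ->
  measurable [set x : R | A (x + t)%R].
Proof.
by move=> mA; rewrite -[X in measurable X]setTI; exact: measurable_translation.
Qed.

(** The image of Lebesgue measure under a translation agrees with it on the intervals []a, b]],
    hence everywhere by uniqueness. *)
Lemma lebesgue_measure_translate (t : R) A : measurable A ->
  mu [set x : R | A (x + t)%R] = mu A.
Proof.
move=> mA.
have mt : measurable_fun [set: measurableTypeR R]
    ((fun x => x + t)%R : measurableTypeR R -> measurableTypeR R).
  exact: measurable_translation.
pose mt_mixin := isMeasurableFun.Build _ _ _ _ _ mt.
pose phi : {mfun measurableTypeR R >-> measurableTypeR R} :=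
  HB.pack (fun x : measurableTypeR R => (x + t)%R) mt_mixin.
rewrite -[LHS]/(pushforward mu phi A).
apply/esym/lebesgue_measure_unique => //= _ [[a b]] _ <-.
rewrite /pushforward /=.
have -> : (fun x => x + t)%R @^-1` `]a, b] = `](a - t)%R, (b - t)%R]%classic.
  apply/seteqP; split => x /=; rewrite !in_itv/=.
    by rewrite ltrBlDr lerBrDr.
  by rewrite ltrBlDr lerBrDr.
by rewrite !lebesgue_measure_itv/= !lte_fin ltrD2r -!EFinB opprB addrA subrK.
Qed.

Lemma ge0_integral_translate (t : R) f : measurable_fun [set: R] f ->
  (forall x, 0 <= f x) -> \int[mu]_x f (x + t)%R = \int[mu]_x f x.
Proof.
move=> mf f0.
have mt : measurable_fun [set: measurableTypeR R]
    ((fun x => x + t)%R : measurableTypeR R -> measurableTypeR R).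
  exact: measurable_translation.
have := @ge0_integral_pushforward _ _ _ _ R _ mt mu setT f measurableT mf
  (fun x _ => f0 x).
rewrite preimage_setT /comp => <-.
apply: eq_measure_integral => A mA _.
exact: lebesgue_measure_translate.
Qed.

End translation.

(** * Countable sums under the integral sign *)

Section countable_sums.
Variables (R : realType) (I : countType).
Local Open Scope ereal_scope.

(** Reindexing by [nat] reduces sums over [I] to series; numbers that code no element contribute
    0. *)
Let extend (a : I -> \bar R) n :=
  if pickle_inv n is Some i then a i else 0.

Let esum_nneseries (a : I -> \bar R) : (forall i, 0 <= a i) ->
  \esum_(i in [set: I]) a i = \sum_(n <oo) extend a n.
Proof.
move=> a0; have e0 n : 0 <= extend a n.
  by rewrite /extend; case: pickle_inv.
rewrite nneseries_esumT//.
transitivity (\esum_(i in [set: I]) extend a (choice.pickle i)).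
  by apply: eq_esum => i _; rewrite /extend pickleK_inv.
rewrite -(esum_image [set: I] choice.pickle (extend a)); last first.
  by move=> i j _ _; exact: (pcan_inj choice.pickleK).
rewrite [RHS](esumID (range (@choice.pickle I)))//.
rewrite setTI [X in _ + X]esum1 ?adde0// => n [_ /= nr].
rewrite /extend; case: pickle_inv (@choice.pickle_invK I n) => //= i in_.
by exfalso; apply: nr; exists i.
Qed.

Lemma ge0_integral_esum (d : measure_display) (T : measurableType d)
    (mu : {measure set T -> \bar R}) (F : I -> T -> \bar R) :
    (forall i, measurable_fun [set: T] (F i)) -> (forall i x, 0 <= F i x) ->
  \int[mu]_x (\esum_(i in [set: I]) F i x) =
  \esum_(i in [set: I]) (\int[mu]_x F i x).
Proof.
move=> mF F0; rewrite esum_nneseries; last by move=> i; exact: integral_ge0.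
transitivity (\int[mu]_x (\sum_(n <oo) extend (F^~ x) n)).
  by apply: eq_integral => x _; rewrite esum_nneseries.
rewrite integral_nneseries//.
- apply: eq_eseriesr => n _; rewrite /extend; case: pickle_inv => //.
  exact: integral0.
- by move=> n; rewrite /extend; case: pickle_inv => //; exact: measurable_cst.
- by move=> n x _; rewrite /extend; case: pickle_inv.
Qed.

Lemma measurable_esum (d : measure_display) (T : measurableType d)
    (F : I -> T -> \bar R) : (forall i, measurable_fun [set: T] (F i)) ->
    (forall i x, 0 <= F i x) ->
  measurable_fun [set: T] (fun x => \esum_(i in [set: I]) F i x).
Proof.
move=> mF F0.
under eq_fun do rewrite esum_nneseries//.
apply: ge0_emeasurable_sum => n.
  by move=> x _ _; rewrite /extend; case: pickle_inv.
by move=> _; rewrite /extend; case: pickle_inv => //; exact: measurable_cst.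
Qed.

(* [F i x] is the mass that [x] sends to [x + t i]. *)
Lemma mass_transport (t : I -> R) (F : I -> R -> \bar R) :
    (forall i, measurable_fun [set: R] (F i)) -> (forall i x, 0 <= F i x) ->
  \int[@lebesgue_measure R]_x (\esum_(i in [set: I]) F i x) =
  \int[@lebesgue_measure R]_x (\esum_(i in [set: I]) F i (x - t i)%R).
Proof.
move=> mF F0; rewrite !ge0_integral_esum//; last first.
  move=> i; apply: measurableT_comp => //; exact: measurable_translation.
by apply: eq_esum => i _; rewrite ge0_integral_translate.
Qed.

End countable_sums.

(** * Invariance of the graph notions under relabelling of the edges *)

Section graph_isomorphism.
Variables (E I : choiceType) (c : bool -> E -> I) (r r' : E -> E).
Hypothesis rc : forall b x y, c b x = c b y -> c b (r x) = c b (r y).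
Hypothesis r'c : forall b x y, c b x = c b y -> c b (r' x) = c b (r' y).
Hypotheses (rK : cancel r r') (r'K : cancel r' r).
Implicit Types (G : set E) (b : bool) (e g h : E).

Lemma conn_preimage G g h : conn c (r @^-1` G) g h <-> conn c G (r g) (r h).
Proof.
have homo (q : E -> E) : (forall b x y, c b x = c b y -> c b (q x) = c b (q y)) ->
    forall H x y, conn c (q @^-1` H) x y -> conn c H (q x) (q y).
  move=> qc H x y [n]; elim: n y => [y [Hx <-]|n IHn y /= [z [/IHn xz Hy [b zy]]]].
    exact: conn_refl.
  exact: conn_rcons xz Hy (qc _ _ _ zy).
split=> [|gh]; first exact: homo.
rewrite -(rK g) -(rK h); apply: homo r'c _ _ _ _.
by rewrite -comp_preimage (_ : r \o r' = id) // funeqE.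
Qed.

Lemma finite_image_iso (A : set E) : finite_set (r @` A) <-> finite_set A.
Proof.
split=> [fA|]; last exact: finite_image.
suff -> : A = r' @` (r @` A) by exact: finite_image.
rewrite image_comp (_ : r' \o r = id) ?image_id// funeqE => x /=; exact: rK.
Qed.

Lemma component_preimage G e :
  component c G (r e) = r @` component c (r @^-1` G) e.
Proof.
apply/seteqP; split=> [h|_ [h eh <-]] /=; last exact/conn_preimage.
by move=> eh; exists (r' h); [apply/conn_preimage; rewrite r'K|rewrite r'K].
Qed.

Lemma side_preimage G b e : side c G b (r e) = r @` side c (r @^-1` G) b e.
Proof.
have GE : (r @^-1` G) `\ e = r @^-1` (G `\ r e).
  apply/seteqP; split=> x /= [Gx xe]; split => // rxe; apply: xe.
    by rewrite -(rK x) rxe rK.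
  by rewrite rxe.
apply/seteqP; split=> [h [s [se cs sh]]|_ [h [s [se cs sh]] <-]].
  exists (r' h); last by rewrite r'K.
  exists (r' s); split.
  - by apply: contra_neq se => <-; rewrite r'K.
  - by rewrite -[X in _ = _ _ X]rK; exact: r'c.
  - by rewrite GE; apply/conn_preimage; rewrite !r'K.
exists (r s); split; last by apply/conn_preimage; rewrite -GE.
- by apply: contra_neq se => /(can_inj rK).
- exact: rc.
Qed.

Lemma share_preimage G b e : share c (r @^-1` G) b e = share c G b (r e).
Proof.
rewrite /share !side_preimage; congr (_ + _)%N; congr nat_of_bool;
  apply/asboolP/asboolP => fin.
- by move/finite_image_iso; exact: fin.
- by move=> ?; apply: fin; exact/finite_image_iso.
- exact/finite_image_iso.
- exact/finite_image_iso.
Qed.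

End graph_isomorphism.

(** * Measurability of graph properties in a parameter *)

Section graph_measurability.
Variables (d : measure_display) (T : measurableType d).

Lemma measurable_exists (I : countType) (P : I -> T -> Prop) :
  (forall i, measurable [set x | P i x]) -> measurable [set x | exists i, P i x].
Proof.
move=> mP; rewrite [X in measurable X](_ : _ = \bigcup_i [set x | P i x]).
  exact: countable_bigcupT_measurable.
by apply/seteqP; split=> x /=; [case=> i; exists i|case=> i _ ?; exists i].
Qed.

Lemma measurable_not (P : T -> Prop) :
  measurable [set x | P x] -> measurable [set x | ~ P x].
Proof. exact: measurableC. Qed.

Lemma measurable_and (P Q : T -> Prop) : measurable [set x | P x] ->
  measurable [set x | Q x] -> measurable [set x | P x /\ Q x].
Proof. exact: measurableI. Qed.

Lemma measurable_const (P : Prop) : measurable [set x : T | P].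
Proof.
have [HP|HP] := pselect P.
  by rewrite (_ : mkset _ = setT)//; apply/seteqP; split.
by rewrite (_ : mkset _ = set0)//; apply/seteqP; split.
Qed.

Lemma measurable_forall (I : countType) (P : I -> T -> Prop) :
  (forall i, measurable [set x | P i x]) -> measurable [set x | forall i, P i x].
Proof.
move=> mP; rewrite [X in measurable X](_ : _ = [set x | ~ exists i, ~ P i x]).
  by apply/measurable_not/measurable_exists => i; exact/measurable_not.
by apply/seteqP; split=> x /=; [move=> Px [j]; apply|move/forallNP => + i => /(_ i)/contrapT].
Qed.

Lemma measurable_imply (P Q : T -> Prop) : measurable [set x | P x] ->
  measurable [set x | Q x] -> measurable [set x | P x -> Q x].
Proof.
move=> mP mQ.
rewrite [X in measurable X](_ : _ = [set x | ~ (P x /\ ~ Q x)]).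
  by apply/measurable_not/measurable_and => //; exact/measurable_not.
apply/seteqP; split=> x /=; first by move=> PQ [/PQ].
by move=> nPQ Px; apply: contrapT => nQ; exact: nPQ.
Qed.

(** A subset of a countable type is finite exactly when its codes are bounded, which is a countable
    combination of measurable conditions. *)
Lemma measurable_finite_set (E : countType) (H : T -> set E) :
  (forall g, measurable [set x | H x g]) ->
  measurable [set x | finite_set (H x)].
Proof.
move=> mH; rewrite [X in measurable X](_ : _ =
    [set x | exists n, forall g, H x g -> (choice.pickle g < n)%N]).
  apply/measurable_exists => n; apply/measurable_forall => g.
  by apply/measurable_imply => //; exact: measurable_const.
apply/seteqP; split=> x /=.
  move=> /finite_fsetP[A AE]; exists (\max_(g <- A) choice.pickle g).+1%N => g.
  by rewrite AE /= ltnS => gA; exact: leq_bigmax_seq.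
move=> [n Hn]; have : finite_set (@choice.unpickle E @` `I_n).
  by apply: finite_image; exact: finite_II.
move=> fin; have : finite_set (Some @` H x).
  apply: sub_finite_set fin => _ [g Hg <-].
  by exists (choice.pickle g); [exact: Hn|rewrite choice.pickleK].
have [->|/set0P[g0 _]] := eqVneq (H x) set0; first by move=> _; exact: finite_set0.
move=> /(finite_image (odflt g0)).
by rewrite !image_comp (_ : _ \o _ = id) ?image_id// funeqE.
Qed.

Variables (E : countType) (I : choiceType) (c : bool -> E -> I).

Lemma measurable_conn (H : T -> set E) g h :
  (forall e, measurable [set x | H x e]) ->
  measurable [set x | conn c (H x) g h].
Proof.
move=> mH; apply: measurable_exists => n; elim: n h => [|n IHn] h /=.
  by apply: measurable_and => //; exact: measurable_const.
apply: measurable_exists => e.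
rewrite [X in measurable X](_ : _ = [set x | walk c (H x) n g e /\
    (H x h /\ exists b, c b e = c b h)]).
  apply: measurable_and => //; apply: measurable_and => //.
  exact: measurable_const.
by apply/seteqP; split=> x /=; [move=> []|move=> [? []]].
Qed.

Lemma measurable_side (H : T -> set E) b e h :
  (forall g, measurable [set x | H x g]) ->
  measurable [set x | side c (H x) b e h].
Proof.
move=> mH; apply: measurable_exists => s.
rewrite [X in measurable X](_ : _ = [set x | (s != e /\ c b s = c b e) /\
    conn c (H x `\ e) s h]).
  apply: measurable_and; first exact: measurable_const.
  apply: measurable_conn => g; apply: measurable_and => //.
  exact: measurable_const.
by apply/seteqP; split=> x /=; [move=> []|move=> [[]]].
Qed.

Lemma measurable_asbool (R : realType) (P : T -> Prop) : measurable [set x | P x] ->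
  measurable_fun [set: T] (fun x => (`[< P x >]%:R)%:E : \bar R).
Proof.
move=> mP; apply/measurable_EFinP.
by have := @measurable_indic _ T R setT _ mP.
Qed.

Lemma measurable_share (R : realType) (H : T -> set E) b e :
  (forall g, measurable [set x | H x g]) ->
  measurable_fun [set: T] (fun x => ((share c (H x) b e)%:R)%:E : \bar R).
Proof.
move=> mH; rewrite /share.
under eq_fun do rewrite natrD EFinD.
by apply: emeasurable_funD; apply: measurable_asbool;
  [apply: measurable_not|]; apply: measurable_finite_set => g;
  exact: measurable_side.
Qed.

End graph_measurability.

(** * The graph of a set along the orbits of the lattice *)

Section esum_card.
Variables (R : realType) (E : choiceType).
Local Open Scope ereal_scope.

Lemma esum_card (P : E -> Prop) (A : {fset E}) : (forall g, P g <-> g \in A) ->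
  \esum_(g in [set: E]) (`[< P g >]%:R)%:E = (#|` A|%:R)%:E :> \bar R.
Proof.
move=> PA; rewrite (esumID [set` A])//.
rewrite setTI setTI [X in _ + X]esum1 ?adde0; last first.
  by move=> g /= gA; rewrite asboolF// => /PA.
rewrite esum_fset// fsbig_finite//=.
rewrite set_fsetK big_seq (eq_bigr (fun=> 1%:E)); last first.
  by move=> g gA; rewrite asboolT//; exact/PA.
by rewrite -big_seq sumEFin big_const_seq count_predT iter_addr_0.
Qed.

Lemma esum_unique (P : E -> Prop) (g0 : E) : (forall g, P g <-> g = g0) ->
  \esum_(g in [set: E]) (`[< P g >]%:R)%:E = 1 :> \bar R.
Proof.
move=> PE; rewrite (@esum_card _ [fset g0]%fset) ?cardfs1// => g.
by rewrite inE; split=> [/PE ->//|/eqP/PE].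
Qed.

End esum_card.

Section orbit_graph.
Variables (R : realType) (gam : bool -> R).
Hypothesis gam_gt0 : forall b, 0 < gam b.
Local Notation V := (int * int)%type.
Local Notation mu := (@lebesgue_measure R).
Implicit Types (b : bool) (g h : V) (x y z : R) (S : set R).

Definition tau g : R := g.1%:~R * gam true + g.2%:~R * gam false.

(* The boolean [true] stands for the period [gam true], so that the
   [true]-endpoint of the edge [g] is its coset modulo [gam true * Z], which is
   determined by the multiple [g.2] of the other period. *)
Definition label b g : int := if b then g.2 else g.1.

Definition dir b (k : int) : V := if b then (k, 0) else (0, k).

Lemma tauD g h : tau (g + h) = tau g + tau h.
Proof. by rewrite /tau !intrD !mulrDl addrACA. Qed.

Lemma tau0 : tau 0 = 0.
Proof. by rewrite /tau !mul0r addr0. Qed.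

Lemma tauN g : tau (- g) = - tau g.
Proof. by apply/eqP; rewrite -addr_eq0 -tauD addNr tau0. Qed.

Lemma tauB g h : tau (g - h) = tau g - tau h.
Proof. by rewrite tauD tauN. Qed.

Lemma tau_dir b k : tau (dir b k) = k%:~R * gam b.
Proof. by case: b; rewrite /tau /= mul0r ?addr0 ?add0r. Qed.

Lemma labelD b g h : label b (g + h) = label b g + label b h.
Proof. by case: b. Qed.

Lemma label_dir b k : label b (dir b k) = 0.
Proof. by case: b. Qed.

Lemma dirK b g : g = dir b (label (~~ b) g) + dir (~~ b) (label b g).
Proof.
case: g => k l; case: b => /=; apply/eqP; rewrite xpair_eqE /= ?addr0 ?add0r;
  by rewrite !eqxx.
Qed.

Lemma label_eqP b g h : label b g = label b h -> exists k, h = g + dir b k.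
Proof.
move=> cgh; exists (label (~~ b) h - label (~~ b) g).
rewrite [in RHS](dirK b g) [LHS](dirK b h) -cgh addrAC; congr (_ + _).
case: b {cgh} => /=; apply/eqP; rewrite xpair_eqE /= ?addr0 ?eqxx ?andbT //=;
  by rewrite addrC subrK.
Qed.

Lemma label_shift g b h h' : label b h = label b h' ->
  label b (g + h) = label b (g + h').
Proof. by rewrite !labelD => ->. Qed.

Lemma itv_translate b x :
  exists k : int, forall l : int, 0 <= x + l%:~R * gam b < gam b <-> l = k.
Proof.
exists (- Num.floor (x / gam b)) => l.
have -> : (0 <= x + l%:~R * gam b < gam b) = (Num.floor (x / gam b) == - l).
  rewrite floor_eq ler_pdivlMr// ltr_pdivrMr//.
  rewrite intrD intrN mulrDl mulNr mul1r; congr andb.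
    by rewrite -lerBlDr sub0r.
  by rewrite [in RHS]addrC ltrBrDr.
by split=> [/eqP ->|->]; rewrite opprK.
Qed.

(** Edges are indexed by lattice vectors relative to the base point [x], so that one countable type
    and one labelling serve all orbits and only the subset of edges varies. Moving the base point is
    a shift of indices. *)
Definition edges S x : set V := [set g | S (x + tau g)].

Lemma edges_tau S x g : edges S (x + tau g) = +%R g @^-1` edges S x.
Proof. by apply/funext => h; rewrite /edges /preimage /mkset tauD -addrA. Qed.

Lemma component_tau S x g h :
  component label (edges S x) (g + h) =
  +%R g @` component label (edges S (x + tau g)) h.
Proof.
rewrite edges_tau; apply: (component_preimage (r' := +%R (- g))).
- by move=> b h1 h2; exact: label_shift.
- by move=> b h1 h2; exact: label_shift.
- exact: addKr.
- exact: addNKr.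
Qed.

Lemma share_tau S x g b h :
  share label (edges S (x + tau g)) b h = share label (edges S x) b (g + h).
Proof.
rewrite edges_tau; apply: (share_preimage (r' := +%R (- g))).
- by move=> b' h1 h2; exact: label_shift.
- by move=> b' h1 h2; exact: label_shift.
- exact: addKr.
- exact: addNKr.
Qed.

Lemma conn_tau S x g h h' :
  conn label (edges S (x + tau g)) h h' <->
  conn label (edges S x) (g + h) (g + h').
Proof.
rewrite edges_tau; apply: (conn_preimage (r' := +%R (- g))).
- by move=> b h1 h2; exact: label_shift.
- by move=> b h1 h2; exact: label_shift.
- exact: addKr.
- exact: addNKr.
Qed.

End orbit_graph.

(** * Finite and infinite components, and counting by mass transport *)

Section counting.
Variables (R : realType) (gam : bool -> R).
Hypothesis gam_gt0 : forall b, 0 < gam b.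
Variable S : set R.
Hypothesis mS : measurable S.
Local Notation V := (int * int)%type.
Local Notation mu := (@lebesgue_measure R).
Local Notation tau := (tau gam).
Local Notation G := (edges gam S).
Local Notation comp x := (component label (G x) 0).
Implicit Types (b : bool) (g h : V) (x y z : R) (P : set R).

Definition finS : set R := [set x | S x /\ finite_set (comp x)].

Definition infS : set R := [set x | S x /\ infinite_set (comp x)].

(* A vertex, i.e. a coset of [gam b * Z], is represented by its unique element in
   [[0, gam b)]. *)
Definition cell b : set R := [set x | 0 <= x < gam b].

Definition vertices b P : set R :=
  [set x | cell b x /\ exists k, P (x + tau (dir b k))].

(** The inequality says that [x] is the least edge of its component as a real number. One edge is
    thus selected per finite component, and the measure of this set counts these components. *)
Definition leftmost : set R := [set x | finS x /\ forall g, comp x g -> 0 <= tau g].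

Lemma edges0 x : G x 0 <-> S x.
Proof. by rewrite /edges /= tau0 addr0. Qed.

Lemma finite_component_tau x g : comp x g ->
  finite_set (comp (x + tau g)) <-> finite_set (comp x).
Proof.
move=> xg; have := component_tau gam S x g 0; rewrite addr0 => E1.
have E2 : comp x = component label (G x) g by apply: component_eq.
have fI := @finite_image_iso _ (+%R g) (+%R (- g)) (addKr g) (comp (x + tau g)).
by rewrite E2 E1 fI.
Qed.

Lemma finS_tau x g : comp x g -> finS x -> finS (x + tau g).
Proof.
by move=> xg [Sx fx]; split; [exact: conn_memr xg|apply/finite_component_tau].
Qed.

Lemma finS_dir x b k k' : S (x + tau (dir b k)) -> S (x + tau (dir b k')) ->
  finS (x + tau (dir b k)) -> finS (x + tau (dir b k')).
Proof.
move=> Sk Sk' fk.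
have -> : x + tau (dir b k') = x + tau (dir b k) + tau (dir b k' - dir b k).
  by rewrite -addrA -tauD (addrC (dir b k)) subrK.
apply: finS_tau fk; apply/conn_tau; rewrite addr0 (addrC (dir b k)) subrK.
by apply: (conn_rcons (b := b) (conn_refl _ Sk) Sk'); rewrite !label_dir.
Qed.

Lemma infS_dir x b k k' : S (x + tau (dir b k)) -> S (x + tau (dir b k')) ->
  infS (x + tau (dir b k)) -> infS (x + tau (dir b k')).
Proof.
move=> Sk Sk' [_ ik]; split => // fk; apply: ik.
by have [|//] := @finS_dir x b k' k Sk' Sk.
Qed.

Lemma measurable_edges g : measurable [set x | G x g].
Proof. exact: measurable_translate. Qed.

Lemma measurable_tau P g : measurable P -> measurable [set x | P (x + tau g)].
Proof. exact: measurable_translate. Qed.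

Lemma measurable_comp g : measurable [set x | comp x g].
Proof. by apply: measurable_conn; exact: measurable_edges. Qed.

Lemma measurable_finS : measurable finS.
Proof.
by apply: measurable_and => //; apply: measurable_finite_set; exact: measurable_comp.
Qed.

Lemma measurable_infS : measurable infS.
Proof.
apply: measurable_and => //; apply: measurable_not; apply: measurable_finite_set.
exact: measurable_comp.
Qed.

Lemma measurable_cell b : measurable (cell b).
Proof.
by rewrite (_ : cell b = `[0, gam b[%classic).
Qed.

Lemma measurable_vertices b P : measurable P -> measurable (vertices b P).
Proof.
move=> mP; apply: measurable_and; first exact: measurable_cell.
by apply: measurable_exists => k; exact: measurable_tau.
Qed.

Lemma measurable_leftmost : measurable leftmost.
Proof.
apply: measurable_and; first exact: measurable_finS.
apply: measurable_forall => g; apply: measurable_imply; first exact: measurable_comp.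
exact: measurable_const.
Qed.

Local Open Scope ereal_scope.

Lemma measure_asbool (D : set R) : measurable D ->
  mu D = \int[mu]_x (`[< D x >]%:R)%:E.
Proof.
by move=> mD; have := integral_indic mu measurableT mD; rewrite setIT => <-.
Qed.

Lemma measure_cell b : mu (cell b) = (gam b)%:E.
Proof.
rewrite (_ : cell b = `[0%R, gam b[%classic)//.
by rewrite lebesgue_measure_itv/= lte_fin gam_gt0 oppr0 adde0.
Qed.

(** Each [y] sends unit mass to [y + tau g] whenever [rel y g]; a point of [D] receives exactly one
    unit and any other point none, so the mass sent is the measure of [D]. *)
Lemma measure_count (D : set R) (rel : R -> V -> Prop) : measurable D ->
    (forall g, measurable [set y | rel y g]) ->
    (forall y g, rel y g -> D (y + tau g)%R) ->
    (forall x, D x -> exists g0, forall g, rel (x - tau g)%R g <-> g = g0) ->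
  mu D = \int[mu]_y (\esum_(g in [set: V]) (`[< rel y g >]%:R)%:E).
Proof.
move=> mD mrel relD Drel; rewrite measure_asbool//.
rewrite (@mass_transport _ _ tau (fun g y => (`[< rel y g >]%:R)%:E)) => [|g|g x].
- apply: eq_integral => x _; have [Dx|nDx] := pselect (D x).
    have [g0 g0P] := Drel x Dx.
    by rewrite (asboolT Dx) (esum_unique R g0P).
  rewrite (asboolF nDx) esum1// => g _; rewrite asboolF// => /relD.
  by rewrite subrK.
- apply: measurable_asbool; exact: mrel.
- by rewrite lee_fin.
Qed.

(** Every [x] sends the mass [u x] to the representative of its coset in [[0, gam b)]. *)
Lemma integral_cell b (u : R -> \bar R) : measurable_fun [set: R] u ->
    (forall x, 0 <= u x) ->
  \int[mu]_x u x = \int[mu]_(y in cell b)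
    (\esum_(k in [set: int]) u (y + tau (dir b k))%R).
Proof.
move=> mu_ u0.
pose F (k : int) x := u x * (`[< cell b (x - tau (dir b k))%R >]%:R)%:E.
transitivity (\int[mu]_x (\esum_(k in [set: int]) F k x)).
  apply: eq_integral => x _.
  have [k0 k0P] := itv_translate gam_gt0 b x.
  have kP (k : int) : cell b (x - tau (dir b k))%R <-> (k = - k0)%R.
    rewrite tau_dir -mulNr -intrN; split=> [/k0P <-|->]; first by rewrite opprK.
    by apply/k0P; rewrite opprK.
  rewrite (esumID [set - k0]%R); last by move=> k _; rewrite mule_ge0.
  rewrite !setTI esum_set1; last by rewrite mule_ge0.
  rewrite [X in _ + X]esum1 ?adde0; last first.
    by move=> k /= kk0; rewrite /F asboolF ?mule0// => /kP.
  by rewrite /F asboolT ?mule1//; exact/kP.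
rewrite (mass_transport (fun k => - tau (dir b k)))%R; last 2 first.
- move=> k; apply: emeasurable_funM => //; apply: measurable_asbool.
  by apply: measurable_translate; exact: measurable_cell.
- by move=> k x; rewrite mule_ge0.
rewrite [RHS]integral_mkcond; apply: eq_integral => y _.
rewrite patchE /F; case: ifPn => [|/negP]; rewrite inE => cy.
  apply: eq_esum => k _.
  by rewrite opprK addrK asboolT ?mule1.
by rewrite esum1// => k _; rewrite opprK addrK asboolF ?mule0.
Qed.

End counting.

(** * Infinite components: at least as many edges as vertices *)

Section infinite_components.
Variables (R : realType) (gam : bool -> R).
Hypothesis gam_gt0 : forall b, 0 < gam b.
Variable S : set R.
Hypothesis mS : measurable S.
Local Notation V := (int * int)%type.
Local Notation mu := (@lebesgue_measure R).
Local Notation tau := (tau gam).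
Local Notation G := (edges gam S).
Local Notation comp x := (component label (G x) 0).
Implicit Types (b : bool) (g h : V) (x y z : R) (P : set R).
Local Open Scope ereal_scope.

Lemma esum_asbool_fin_num (I : choiceType) (P : I -> Prop) :
  \esum_(i in [set: I]) (`[< P i >]%:R)%:E \is a @fin_num R ->
  finite_set [set i | P i].
Proof.
move=> fin; apply: contrapT => infP.
set s := (X in X \is a _) in fin.
(* [n] exceeds the supposedly finite sum, while an infinite set has at least [n] distinct
   elements. *)
pose n := (Num.truncn (fine s)).+1.
have [A AP nA] := infinite_set_fset n infP.
have : (n%:R)%:E <= s.
  apply: esum_ge; exists [set` A]; first by split => //; exact: finite_fset.
  rewrite fsbig_finite//= set_fsetK big_seq (eq_bigr (fun=> 1)); last first.
    by move=> g gA; rewrite asboolT//; exact: AP.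
  rewrite -big_seq sumEFin big_const_seq count_predT iter_addr_0 lee_fin.
  by rewrite ler_nat.
rewrite -(fineK fin) lee_fin leNgt => /negP; apply.
exact: truncnS_gt.
Qed.

(** The number of points of [S] in the coset of [y] integrates over the cell to the measure of [S],
    so it is finite almost everywhere. *)
Lemma ae_finite_coset b : mu S < +oo ->
  {ae mu, forall y, cell gam b y ->
    finite_set [set k | S (y + tau (dir b k))%R]}.
Proof.
move=> finS.
pose u x : \bar R := (`[< S x >]%:R)%:E.
have mu_ : measurable_fun [set: R] u by exact: measurable_asbool.
have u0 x : 0 <= u x by rewrite lee_fin.
pose U y := \esum_(k in [set: int]) u (y + tau (dir b k))%R.
have mU : measurable_fun [set: R] U.
  apply: measurable_esum => // k; apply: measurableT_comp => //.
  exact: measurable_translation.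
have U0 y : 0 <= U y by exact: esum_ge0.
have intU : mu.-integrable (cell gam b) U.
  apply/integrableP; split; first exact: measurable_funTS.
  under eq_integral do rewrite gee0_abs//.
  by rewrite -integral_cell// -measure_asbool.
have mc : measurable (cell gam b : set (measurableTypeR R)).
  exact: measurable_cell.
have := integrable_ae mc intU.
apply: filterS => y Uy cy.
exact/esum_asbool_fin_num/Uy.
Qed.

(** The right-hand integral is gathered coset by coset. Almost every coset meets [S] finitely often,
    so [share_vertex] applies to it; the factor 2 appears because [share] is measured in halves. *)
Lemma le_vertices_infS b : mu S < +oo ->
  2%:E * mu (vertices gam b (infS gam S)) <=
  \int[mu]_x ((`[< infS gam S x >]%:R)%:E * ((share label (G x) b 0)%:R)%:E).
Proof.
move=> finS; set D := vertices _ _ _.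
have mD : measurable D by apply: measurable_vertices; exact: measurable_infS.
have minf : measurable_fun [set: R]
    (fun x => (`[< infS gam S x >]%:R)%:E : \bar R).
  by apply: measurable_asbool; exact: measurable_infS.
have mshare : measurable_fun [set: R]
    (fun x => ((share label (G x) b 0)%:R)%:E : \bar R).
  by apply: measurable_share; exact: measurable_edges.
rewrite (integral_cell gam_gt0 b); last 2 first.
- exact: emeasurable_funM.
- by move=> x; rewrite mule_ge0// lee_fin.
rewrite measure_asbool// -ge0_integralZl//; last exact: measurable_asbool.
pose U y : \bar R := \esum_(k in [set: int])
  ((`[< infS gam S (y + tau (dir b k))%R >]%:R)%:E *
   ((share label (G (y + tau (dir b k))%R) b 0)%:R)%:E).
rewrite -[leRHS]/(\int[mu]_(y in cell gam b) U y).
have mU : measurable_fun [set: R] U.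
  apply: measurable_esum => [k|k x]; last by rewrite mule_ge0// lee_fin.
  apply: emeasurable_funM.
    by apply: (measurableT_comp minf); exact: measurable_translation.
  by apply: (measurableT_comp mshare); exact: measurable_translation.
rewrite [leLHS](_ : _ =
    \int[mu]_(x in cell gam b) (2%:E * (`[< D x >]%:R)%:E)); last first.
  rewrite [RHS]integral_mkcond; apply: eq_integral => x _; rewrite patchE.
  case: ifPn => // /negP; rewrite inE => ncx.
  by rewrite asboolF ?mule0// => -[].
apply: ae_ge0_le_integral.
- exact: measurable_cell.
- by move=> x _; rewrite mule_ge0// lee_fin.
- apply: measurable_funTS; apply: emeasurable_funM => //.
  exact: measurable_asbool.
- by move=> x _; apply: esum_ge0 => k _; rewrite mule_ge0// lee_fin.
- exact: measurable_funTS.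
have := ae_finite_coset b finS.
apply: (@filterS _ _ (ae_filter_ringOfSetsType mu)) => y finy /[dup] cy /finy {}finy.
have [[_ [k0 infk0]]|nDy] := pselect (D y); last first.
  rewrite asboolF// mule0; apply: esum_ge0 => k _.
  by rewrite mule_ge0// lee_fin.
rewrite asboolT ?mule1; last by split => //; exists k0.
have Gk0 : G y (dir b k0) by case: infk0.
(* Every edge at the vertex of [dir b k0] is a point of the coset of [y] and belongs to the same
   infinite component. *)
have cosetE s : G y s -> label b s = label b (dir b k0) ->
    exists2 k, s = dir b k & infS gam S (y + tau (dir b k))%R.
  move=> Gs /esym/label_eqP[k sE].
  have {}sE : s = dir b (k0 + k).
    by rewrite sE; case: (b) => /=; apply/eqP; rewrite xpair_eqE /= ?addr0 !eqxx.
  exists (k0 + k)%R => //; rewrite sE in Gs.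
  exact: infS_dir infk0.
(* The share computed from the base point [y + tau (dir b k)] is the share of the edge [dir b k]
   seen from [y]. *)
have term k : infS gam S (y + tau (dir b k))%R ->
    (`[< infS gam S (y + tau (dir b k))%R >]%:R)%:E *
    ((share label (G (y + tau (dir b k))%R) b 0)%:R)%:E =
    ((share label (G y) b (dir b k))%:R)%:E :> \bar R.
  by move=> infk; rewrite asboolT// mul1e share_tau addr0.
have infe : infinite_set (component label (G y) (dir b k0)).
  case: infk0 => _ infk0 fin; apply: infk0.
  apply/(finite_image_iso (addKr (dir b k0))).
  by rewrite -component_tau addr0.
have fine : finite_set
    [set s | G y s /\ label b s = label b (dir b k0)].
  apply: sub_finite_set (finite_image (dir b) finy) => s [Gs ls].
  by have [k sE [Sk _]] := cosetE s Gs ls; exists k.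
have [[s [Gs ls us]]|[s [t [[Gs ls] [Gt lt] st us ut]]]] :=
    share_vertex infe fine Gk0.
  have [k sE infk] := cosetE s Gs ls.
  apply: esum_ge; exists [set k]; first by split => //; exact: finite_set1.
  by rewrite fsbig_set1 term// -sE lee_fin ler_nat.
have [k sE infk] := cosetE s Gs ls.
have [l tE infl] := cosetE t Gt lt.
apply: esum_ge; exists [set` [fset k; l]%fset].
  by split => //; exact: finite_fset.
rewrite fsbig_finite//= set_fsetK big_fsetU1/=; last first.
  by rewrite inE; apply: contra_neq st => kl; rewrite sE tE kl.
rewrite big_seq_fset1 !term// -sE -tE -EFinD -natrD lee_fin ler_nat.
by rewrite -[2%N]/(1 + 1)%N leq_add.
Qed.

(** When the bounds for the two colours are added, the shares of each edge add up to 2, and the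
    factor 2 cancels. *)
Lemma measure_infS_ge : mu S < +oo ->
  mu (vertices gam true (infS gam S)) + mu (vertices gam false (infS gam S)) <=
  mu (infS gam S).
Proof.
move=> finS.
have mI : measurable (infS gam S) by exact: measurable_infS.
have minf : measurable_fun [set: R]
    (fun x => (`[< infS gam S x >]%:R)%:E : \bar R).
  exact: measurable_asbool.
have mshare b : measurable_fun [set: R]
    (fun x => ((share label (G x) b 0)%:R)%:E : \bar R).
  by apply: measurable_share; exact: measurable_edges.
have mprod b : measurable_fun [set: R] (fun x =>
    (`[< infS gam S x >]%:R)%:E * ((share label (G x) b 0)%:R)%:E : \bar R).
  exact: emeasurable_funM.
rewrite -(@lee_pmul2l _ 2%:E)// ge0_muleDr//.
apply: le_trans (leeD (le_vertices_infS true finS) (le_vertices_infS false finS)) _.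
rewrite -ge0_integralD//; last 2 first.
- exact: mprod.
- exact: mprod.
rewrite measure_asbool// -ge0_integralZl//.
rewrite le_eqVlt; apply/orP; left; apply/eqP; apply: eq_integral => x _.
by rewrite -muleDr// -EFinD -natrD share_sum muleC.
Qed.

End infinite_components.

(** * Finite components: counting edges and vertices from the leftmost edge *)

Section finite_components.
Variables (R : realType) (gam : bool -> R).
Hypothesis gam_gt0 : forall b, 0 < gam b.
Hypothesis gam_indep : rationally_independent (gam true) (gam false).
Variable S : set R.
Hypothesis mS : measurable S.
Local Notation V := (int * int)%type.
Local Notation mu := (@lebesgue_measure R).
Local Notation tau := (tau gam).
Local Notation G := (edges gam S).
Local Notation comp x := (component label (G x) 0).
Local Notation finS := (finS gam S).
Local Notation leftmost := (leftmost gam S).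
Implicit Types (b : bool) (g h : V) (x y z : R) (P : set R).

Lemma tau_inj : injective tau.
Proof.
move=> [k l] [k' l'] /eqP; rewrite -subr_eq0 -tauB => /eqP /gam_indep[/= /eqP + /eqP].
by rewrite !subr_eq0 => /eqP -> /eqP ->.
Qed.

Lemma exists_tau_min (A : {fset V}) g0 : g0 \in A ->
  exists2 m, m \in A & forall g, g \in A -> tau m <= tau g.
Proof.
have H (s : seq V) (g : V) : exists2 m, m \in g :: s &
    forall h, h \in g :: s -> tau m <= tau h.
  elim: s g => [|h s IHs] g.
    by exists g; rewrite ?inE// => h; rewrite inE => /eqP ->.
  have [m ms mmin] := IHs h.
  have [gm|mg] := leP (tau g) (tau m).
    exists g; first exact: mem_head.
    by move=> h'; rewrite inE => /predU1P[->//|/mmin]; exact: le_trans.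
  exists m; first by rewrite inE ms orbT.
  by move=> h'; rewrite inE => /predU1P[->|/mmin//]; exact: ltW.
move=> g0A; have : (enum_fset A) != [::].
  by apply: contraTneq g0A => A0; rewrite -[_ \in A]/(_ \in enum_fset A) A0.
case E : (enum_fset A) => [//|g s] _.
have [m ms mmin] := H s g.
by exists m => [|h]; rewrite -[_ \in A]/(_ \in enum_fset A) E//; exact: mmin.
Qed.

(** A finite component has a least edge, unique because independence makes [tau] injective. *)
Lemma finS_leftmost x : finS x ->
  exists g0, forall g, leftmost (x - tau g) /\ comp (x - tau g) g <-> g = g0.
Proof.
move=> [Sx fx].
have xx : comp x 0 by apply: conn_refl; exact/edges0.
have [m] : exists2 m, m \in fset_set (comp x) &
    forall g, g \in fset_set (comp x) -> tau m <= tau g.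
  by apply: (@exists_tau_min _ 0); rewrite in_fset_set// inE.
rewrite in_fset_set// inE => xm mmin.
have {}mmin g : comp x g -> tau m <= tau g.
  by move=> xg; apply: mmin; rewrite in_fset_set// inE.
(* [x + tau m] is the least edge of the component, and [- m] leads from it back to [x]. *)
exists (- m) => g; rewrite -tauN; split=> [[[_ leftmostmin] xg]|->].
  have {}xg : comp x (- g).
    by move/conn_tau : xg; rewrite addr0 addNr => /conn_sym.
  apply/eqP; rewrite eq_sym eqr_oppLR eq_sym; apply/eqP; apply: tau_inj.
  apply/eqP; rewrite eq_le mmin// andbT.
  have := leftmostmin (m + g); rewrite tauD -lerBlDr sub0r -tauN; apply.
  apply/conn_tau; rewrite addr0 addrCA addNr addr0.
  exact: conn_trans (conn_sym xg) xm.
rewrite opprK; split; last first.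
  by apply/conn_tau; rewrite addr0 subrr; exact: conn_sym.
split; first by apply: finS_tau.
move=> h /conn_tau; rewrite addr0 => mh.
have := mmin (m + h) (conn_trans xm mh).
by rewrite tauD lerDl.
Qed.

Let C y : {fset V} := fset_set (comp y).

Let inC y g : leftmost y -> (g \in C y) <-> comp y g.
Proof. by move=> [[_ fy] _]; rewrite in_fset_set// inE. Qed.

Let nV b y := #|` [fset label b g | g in C y]%fset|.

Definition rel_edge y g := leftmost y /\ comp y g.

(** A leftmost edge [y] is related to the cell representatives of the [b]-vertices of its component.
    Such a representative need not be an edge, hence the auxiliary edge [h] on the same vertex. *)
Definition rel_vertex b y g := [/\ leftmost y, cell gam b (y + tau g) &
  exists2 h, comp y h & label b h = label b g].

Lemma rel_vertex_inv b y g : rel_vertex b y g ->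
  vertices gam b finS (y + tau g).
Proof.
move=> [[fy _] cg [h yh lh]]; split => //.
have [k hk] := label_eqP (esym lh).
by exists k; rewrite -addrA -tauD -hk; exact: finS_tau.
Qed.

(** Some edge [x + tau (dir b k)] lies on the vertex of [x]. A leftmost edge reaches this vertex
    exactly when it reaches that edge, so existence and uniqueness come from [finS_leftmost] after a
    shift by [dir b k]. *)
Lemma vertices_leftmost b x : vertices gam b finS x ->
  exists g0, forall g, rel_vertex b (x - tau g) g <-> g = g0.
Proof.
move=> [cx [k fxk]]; have [g0 g0P] := finS_leftmost fxk.
have shift g : x + tau (dir b k) - tau (g + dir b k) = x - tau g.
  by rewrite tauD (addrC (tau g)) addrKA.
exists (g0 - dir b k) => g.
have -> : (g = g0 - dir b k) <-> (g + dir b k = g0).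
  by split=> [->|<-]; rewrite ?subrK ?addrK.
rewrite -g0P shift /rel_vertex subrK; split=> [[rg _ [h gh lh]]|[rg gg]].
  split => //; apply: (conn_rcons (b := b) gh).
    by rewrite /edges /= tauD addrA subrK; case: fxk.
  by rewrite lh labelD label_dir addr0.
split => //; exists (g + dir b k) => //.
by rewrite labelD label_dir addr0.
Qed.

Lemma measurable_rel_edge g : measurable [set y | rel_edge y g].
Proof.
apply: measurable_and; first exact: measurable_leftmost.
exact: measurable_comp.
Qed.

Lemma measurable_rel_vertex b g : measurable [set y | rel_vertex b y g].
Proof.
rewrite [X in measurable X](_ : _ = [set y | leftmost y /\ (cell gam b (y + tau g) /\
    exists h, comp y h /\ label b h = label b g)]).
  apply: measurable_and; first exact: measurable_leftmost.
  apply: measurable_and; first by apply: measurable_translate; exact: measurable_cell.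
  apply: measurable_exists => h; apply: measurable_and.
    exact: measurable_comp.
  exact: measurable_const.
apply/seteqP; split=> y /=; first by move=> [ry cy [h yh lh]]; do !split => //; exists h.
by move=> [ry [cy [h [yh lh]]]]; split => //; exists h.
Qed.

Local Open Scope ereal_scope.

Let nE_sum y := \esum_(g in [set: V]) (`[< rel_edge y g >]%:R)%:E : \bar R.

Let nV_sum b y := \esum_(g in [set: V]) (`[< rel_vertex b y g >]%:R)%:E : \bar R.

Let nE_sumE y : leftmost y -> nE_sum y = (#|` C y|%:R)%:E.
Proof.
by move=> ry; apply: esum_card => g; rewrite inC//; split=> [[]|].
Qed.

Let nV_sumE b y : leftmost y -> nV_sum b y = ((nV b y)%:R)%:E.
Proof.
move=> ry.
(* In the coset with label [l], [k l] marks the unique point of the cell; [rep] then matches the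
   labels of the component with its vertices in the cell. *)
have /choice[k kP] : forall l : int, exists k : int, forall j : int,
    cell gam b (y + tau (dir (~~ b) l + dir b j))%R <-> j = k.
  move=> l; have [k kP] := itv_translate gam_gt0 b (y + tau (dir (~~ b) l)).
  by exists k => j; rewrite tauD addrA (tau_dir gam b); exact: kP.
pose rep l := (dir (~~ b) l + dir b (k l))%R.
have label_rep l : label b (rep l) = l.
  by rewrite /rep; case: (b) => /=; rewrite ?addr0 ?add0r.
rewrite /nV_sum (@esum_card _ _ _ [fset rep l | l in
    [fset label b g | g in C y]]%fset).
  rewrite card_in_imfset//= => l l' _ _ /(congr1 (label b)).
  by rewrite !label_rep.
move=> g; split=> [[_ cg [h yh lh]]|/imfsetP[l /= /imfsetP[h /= /inC yh ->] ->]].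
  apply/imfsetP; exists (label b g) => /=.
    by rewrite -lh; apply/imfsetP; exists h => //=; exact/inC.
  rewrite [LHS](dirK b) addrC /rep; congr (_ + dir _ _)%R; apply/kP.
  by rewrite (addrC (dir _ _)) -dirK.
split => //; first by rewrite /rep; exact/kP.
by exists h; [exact: yh|rewrite label_rep].
Qed.

Let nE_sum0 y : ~ leftmost y -> nE_sum y = 0.
Proof. by move=> nry; apply: esum1 => g _; rewrite asboolF// => -[]. Qed.

Let nV_sum0 b y : ~ leftmost y -> nV_sum b y = 0.
Proof. by move=> nry; apply: esum1 => g _; rewrite asboolF// => -[]. Qed.

Let measure_finS : mu finS = \int[mu]_y nE_sum y.
Proof.
apply: measure_count.
- exact: measurable_finS.
- exact: measurable_rel_edge.
- by move=> y g [[fy _] yg]; exact: finS_tau.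
- exact: finS_leftmost.
Qed.

Let measure_vertices b : mu (vertices gam b finS) = \int[mu]_y nV_sum b y.
Proof.
apply: measure_count.
- by apply: measurable_vertices; exact: measurable_finS.
- exact: measurable_rel_vertex.
- exact: rel_vertex_inv.
- exact: vertices_leftmost.
Qed.

Let m_nE : measurable_fun [set: R] nE_sum.
Proof.
apply: measurable_esum => g; last by move=> x; rewrite lee_fin.
by apply: measurable_asbool; exact: measurable_rel_edge.
Qed.

Let m_nV b : measurable_fun [set: R] (nV_sum b).
Proof.
apply: measurable_esum => g; last by move=> x; rewrite lee_fin.
by apply: measurable_asbool; exact: measurable_rel_vertex.
Qed.

Let m_leftmost : measurable_fun [set: R] (fun y => (`[< leftmost y >]%:R)%:E : \bar R).
Proof. by apply: measurable_asbool; exact: measurable_leftmost. Qed.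

Let nE_ge0 y : 0 <= nE_sum y.
Proof. by apply: esum_ge0 => g _; rewrite lee_fin. Qed.

Let nV_ge0 b y : 0 <= nV_sum b y.
Proof. by apply: esum_ge0 => g _; rewrite lee_fin. Qed.

(** The bound of [card_component_le] is integrated over the leftmost edges, one for each component;
    its summand 1 gives the measure of [leftmost]. *)
Lemma measure_finS_ge :
  mu (vertices gam true finS) + mu (vertices gam false finS) <=
  mu finS + mu leftmost.
Proof.
have mr : measurable leftmost by exact: measurable_leftmost.
have mV : measurable_fun [set: R] (fun y => nV_sum true y + nV_sum false y).
  exact: emeasurable_funD.
have mE : measurable_fun [set: R] (fun y => nE_sum y + (`[< leftmost y >]%:R)%:E).
  exact: emeasurable_funD.
rewrite !measure_vertices measure_finS (measure_asbool mr).
rewrite -!ge0_integralD//; [|exact: m_nV|exact: m_nV].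
apply: ge0_le_integral => //; first by move=> y _; rewrite adde_ge0.
move=> y _; have [ry|nry] := pselect (leftmost y).
  rewrite !nV_sumE// nE_sumE// asboolT// -!EFinD -!natrD lee_fin ler_nat.
  have [[Sy fy] _] := ry.
  by apply: card_component_le => //; exact/edges0.
by rewrite !nV_sum0// nE_sum0// asboolF// !adde0.
Qed.

(** [lev] stands for the pair [p], [q]. The hypothesis on components results from summing $f$ over a
    finite component by rows and by columns. *)
Variable lev : bool -> nat.
Hypothesis lev_coprime : coprime (lev true) (lev false).
Hypothesis component_level : forall y, S y -> finite_set (comp y) ->
  (lev true * #|` [fset label true g | g in fset_set (comp y)]%fset| =
   lev false * #|` [fset label false g | g in fset_set (comp y)]%fset|)%N.

Let nV_gt0 b y : leftmost y -> (0 < nV b y)%N.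
Proof.
move=> [[Sy fy] _]; rewrite cardfs_gt0; apply/fset0Pn; exists (label b 0%R).
apply/imfsetP; exists 0%R => //=; rewrite in_fset_set// inE.
by apply: conn_refl; exact/edges0.
Qed.

(** By coprimality, [lev (~~ b)] divides the number of [b]-vertices of a finite component; this
    number is positive, so it is at least [lev (~~ b)]. The bound is integrated over the leftmost
    edges. *)
Lemma measure_leftmost_le b :
  ((lev (~~ b))%:R)%:E * mu leftmost <= mu (vertices gam b finS).
Proof.
have mr : measurable leftmost by exact: measurable_leftmost.
have mleftmostZ : measurable_fun [set: R]
    (fun y => ((lev (~~ b))%:R)%:E * (`[< leftmost y >]%:R)%:E : \bar R).
  exact: emeasurable_funM.
rewrite measure_vertices (measure_asbool mr) -ge0_integralZl//.
apply: ge0_le_integral => //; first exact: m_nV.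
move=> y _; have [ry|nry] := pselect (leftmost y); last first.
  by rewrite asboolF// mule0.
rewrite nV_sumE// asboolT// mule1 lee_fin ler_nat dvdn_leq ?nV_gt0//.
have [[Sy fy] _] := ry; have := component_level Sy fy.
rewrite -/(nV true y) -/(nV false y) => lvl.
case: b mleftmostZ => _ /=.
  rewrite -(@Gauss_dvdr _ (lev true)) ?lvl ?dvdn_mulr//.
  by rewrite coprime_sym.
by rewrite -(@Gauss_dvdr _ (lev false)) -?lvl ?dvdn_mulr.
Qed.

Lemma measure_vertices_level :
  ((lev true)%:R)%:E * mu (vertices gam true finS) =
  ((lev false)%:R)%:E * mu (vertices gam false finS).
Proof.
rewrite !measure_vertices -!ge0_integralZl//; [|exact: m_nV|exact: m_nV].
apply: eq_integral => y _; have [ry|nry] := pselect (leftmost y); last first.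
  by rewrite !nV_sum0// !mule0.
have [[Sy fy] _] := ry.
by rewrite !nV_sumE// -!EFinM -!natrM component_level.
Qed.

End finite_components.

(** * The lower bound for the measure of the edge set *)

Section lower_bound.
Variables (R : realType) (gam : bool -> R).
Hypothesis gam_gt0 : forall b, 0 < gam b.
Hypothesis gam_indep : rationally_independent (gam true) (gam false).
Variable S : set R.
Hypothesis mS : measurable S.
Local Notation V := (int * int)%type.
Local Notation mu := (@lebesgue_measure R).
Local Notation tau := (tau gam).
Local Notation G := (edges gam S).
Local Notation comp x := (component label (G x) 0).
Local Notation finS := (finS gam S).
Local Notation infS := (infS gam S).
Implicit Types (b : bool) (g h : V) (x y z : R) (P : set R).
Local Open Scope ereal_scope.

Lemma measure0_exists (I : countType) (P : I -> set R) :
  (forall i, measurable (P i)) -> (forall i, mu (P i) = 0) ->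
  mu [set x | exists i, P i x] = 0.
Proof.
move=> mP P0; apply/(negligibleP mu); first exact: measurable_exists.
rewrite (_ : mkset _ = \bigcup_n
    (if choice.pickle_inv n is Some i then P i else set0)).
  apply: negligible_bigcup => n; case: choice.pickle_inv => [i|].
    by apply/(negligibleP mu); [exact: mP|exact: P0].
  exact: negligible_set0.
apply/seteqP; split=> [x [j Pj]|x [n _]].
  by exists (choice.pickle j) => //; rewrite choice.pickleK_inv.
by case: choice.pickle_inv => // j Pj; exists j.
Qed.

(** An edge at a vertex of one colour is also at a vertex of the other. Hence the [~~ b]-vertices in
    question lie in countably many translates of the [b]-vertices, which are null. *)
Lemma measure_vertices_infS0 b : mu (vertices gam b infS) = 0 ->
  mu (vertices gam (~~ b) infS) = 0.
Proof.
move=> mu0; have mI : measurable infS by exact: measurable_infS.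
have mV b' : measurable (vertices gam b' infS) by exact: measurable_vertices.
pose P (g : V) : set R := [set x | vertices gam b infS (x + tau g)%R].
have mP g : measurable (P g) by exact: measurable_tau.
have := @measure0_exists _ P mP.
have P0 g : mu (P g) = 0 by rewrite lebesgue_measure_translate.
move=> /(_ P0) PE; apply/eqP; rewrite eq_le measure_ge0 andbT -PE.
apply: le_measure; rewrite ?inE; [exact: mV|exact: (measurable_exists mP)|].
move=> y [_ [k infk]].
have [j jP] := itv_translate gam_gt0 b (y + tau (dir (~~ b) k)).
exists (dir (~~ b) k + dir b j)%R; split.
  by rewrite /cell /= tauD addrA (tau_dir gam b); apply/jP.
exists (- j)%R; rewrite -addrA -tauD -(addrA (dir _ _)).
suff -> : (dir b j + dir b (- j) = 0)%R by rewrite addr0.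
by case: (b); apply/eqP; rewrite xpair_eqE /= ?addr0 ?subrr !eqxx.
Qed.

Hypothesis cover : forall b,
  mu (cell gam b `\` [set x | exists k, S (x + tau (dir b k))%R]) = 0.

(** Almost every coset contains an edge, and edges on a common vertex share their component, so the
    finite and infinite vertices split the cell up to a null set. *)
Lemma measure_verticesD b :
  mu (vertices gam b finS) + mu (vertices gam b infS) = (gam b)%:E.
Proof.
have mI : measurable infS by exact: measurable_infS.
have mF : measurable finS by exact: measurable_finS.
have mV P : measurable P -> measurable (vertices gam b P).
  exact: measurable_vertices.
have mcover : measurable [set x | exists k, S (x + tau (dir b k))%R].
  by apply: measurable_exists => k; exact: measurable_tau.
have mc : measurable (cell gam b) by exact: measurable_cell.
rewrite -(measure_cell gam_gt0 b) (measureDI mu mc mcover).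
rewrite [X in _ = X + _](cover b) add0e.
rewrite -measureU; [|exact: mV|exact: mV|]; last first.
  apply/seteqP; split=> // x [[_ [k [Sk fk]]] [_ [l [Sl infl]]]].
  apply: infl; have [] := @finS_dir _ gam S x b k l Sk Sl => //.
congr (mu _); apply/seteqP; split=> [x [[cx [k [Sk _]]]|[cx [k [Sk _]]]]|].
- by split => //; exists k.
- by split => //; exists k.
move=> x [cx [k Sk]].
have [fk|infk] := pselect (finite_set (comp (x + tau (dir b k))%R)).
  by left; split => //; exists k.
by right; split => //; exists k.
Qed.

Variable lev : bool -> nat.
Hypothesis lev_gt0 : forall b, (0 < lev b)%N.
Hypothesis lev_coprime : coprime (lev true) (lev false).
Hypothesis component_level : forall y, S y -> finite_set (comp y) ->
  (lev true * #|` [fset label true g | g in fset_set (comp y)]%fset| =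
   lev false * #|` [fset label false g | g in fset_set (comp y)]%fset|)%N.

Lemma measure_gt : (gam true + gam false -
    Num.min (gam true / (lev false)%:R) (gam false / (lev true)%:R))%:E < mu S.
Proof.
have [Soo|Soo] := eqVneq (mu S) +oo; first by rewrite Soo ltry.
have {}Soo : mu S < +oo by rewrite ltey.
have mI : measurable infS by exact: measurable_infS.
have mF : measurable finS by exact: measurable_finS.
have SE : mu S = mu finS + mu infS.
  rewrite -measureU//; last by apply/seteqP; split=> // x [[_ fx] [_]].
  congr (mu _); apply/seteqP; split=> [x Sx|x [[]|[]]//].
  by have [fx|ix] := pselect (finite_set (comp x)); [left|right].
(* The measures are turned into real numbers: two nonnegative summands of a finite sum are
   finite. *)
have real (x y : \bar R) (r : R) : 0 <= x -> 0 <= y -> x + y = r%:E ->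
    exists u v : R, x = u%:E /\ y = v%:E.
  by case: x y => [u| |] [v| |]//= _ _ _; exists u, v.
have S_fin : mu S = (fine (mu S))%:E by rewrite fineK// ge0_fin_numE.
have [sf [si [sfE siE]]] : exists sf si : R, mu finS = sf%:E /\ mu infS = si%:E.
  by apply: (@real _ _ (fine (mu S))) => //; rewrite -SE.
have vE b : exists u v : R,
    mu (vertices gam b finS) = u%:E /\ mu (vertices gam b infS) = v%:E.
  by apply: (@real _ _ (gam b)) => //; exact: measure_verticesD.
have [af [ai [afE aiE]]] := vE true.
have [bf [bi [bfE biE]]] := vE false.
have [t tE] : exists t : R, mu (leftmost gam S) = t%:E.
  have := measure_leftmost_le gam_gt0 gam_indep mS lev_coprime component_level true.
  rewrite afE => leftmost_le; exists (fine (mu (leftmost gam S))); rewrite fineK//.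
  rewrite ge0_fin_numE// ltey; apply/eqP => leftmost_oo; move: leftmost_le.
  by rewrite leftmost_oo gt0_muley ?lte_fin ?ltr0n ?lev_gt0.
have := measure_verticesD true; rewrite afE aiE => -[alphaE].
have := measure_verticesD false; rewrite bfE biE => -[betaE].
have := measure_finS_ge gam_gt0 gam_indep mS.
rewrite afE bfE sfE tE -!EFinD lee_fin => fin_le.
have := measure_infS_ge gam_gt0 mS Soo.
rewrite aiE biE siE -EFinD lee_fin => inf_le.
have := measure_leftmost_le gam_gt0 gam_indep mS lev_coprime component_level true.
have := measure_leftmost_le gam_gt0 gam_indep mS lev_coprime component_level false.
rewrite afE bfE tE -!EFinM !lee_fin /= => bf_ge af_ge.
have := measure_vertices_level gam_gt0 gam_indep mS component_level.
rewrite afE bfE -!EFinM => -[levelE].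
have ai_ge0 : (0 <= ai)%R by rewrite -lee_fin -aiE.
have bi_ge0 : (0 <= bi)%R by rewrite -lee_fin -biE.
(* If both colours were null in the infinite part, the level equation would read [lev true * gam
   true = lev false * gam false], against independence. *)
have ai_bi : ~ (ai = 0 /\ bi = 0)%R.
  move=> [ai0 bi0]; move: levelE.
  rewrite -[af]addr0 -[bf]addr0 -{1}ai0 -bi0 alphaE betaE => /eqP.
  rewrite -subr_eq0 -mulNr => /eqP lvl0.
  have [] := gam_indep (n := (lev true)%:Z) (m := (- (lev false)%:Z)%R).
    by rewrite intrN.
  by move=> [lev0]; have := lev_gt0 true; rewrite lev0.
(* If one colour is null, so is the other; hence both are positive, which makes the bound on [t]
   strict. *)
have ai_gt0 : (0 < ai)%R.
  rewrite lt_neqAle ai_ge0 andbT eq_sym; apply/eqP => ai0; apply: ai_bi.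
  split => //; have := @measure_vertices_infS0 true.
  by rewrite aiE biE ai0 => /(_ erefl)[].
have bi_gt0 : (0 < bi)%R.
  rewrite lt_neqAle bi_ge0 andbT eq_sym; apply/eqP => bi0; apply: ai_bi.
  split => //; have := @measure_vertices_infS0 false.
  by rewrite aiE biE bi0 => /(_ erefl)[].
have t_lt : (t < Num.min (gam true / (lev false)%:R) (gam false / (lev true)%:R))%R.
  rewrite lt_min !ltr_pdivlMr ?ltr0n// -alphaE -betaE.
  rewrite [(t * (lev false)%:R)%R]mulrC [(t * (lev true)%:R)%R]mulrC.
  by rewrite (le_lt_trans af_ge) ?ltrDl// (le_lt_trans bf_ge)// ltrDl.
(* The sum of the two periods is [(af + bf) + (ai + bi)], which is at most [(sf + t) + si]. *)
rewrite SE sfE siE -EFinD lte_fin -alphaE -betaE ltrBlDr alphaE betaE.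
apply: le_lt_trans (_ : (_ <= sf + si + t)%R) _; last by rewrite ltrD2l.
by rewrite -alphaE -betaE addrACA [leRHS]addrAC lerD.
Qed.

End lower_bound.

(** * From Lebesgue measurable sets and series to Borel sets and finite sums *)

Section lebesgue_measurable.
Variable R : realType.
Local Notation mu := (@lebesgue_measure R).

(** The Caratheodory sigma-algebra is the completion of the Borel one. This lets the graph argument
    be carried out for Borel sets only. *)
Lemma lebesgue_measurable_decomp (A : set (lebesgueType R)) : measurable A ->
  exists B N : set R, [/\ measurable B, mu N = 0%E, measurable N, B `<=` A &
    A `<=` B `|` N].
Proof.
move=> mA.
have : completed_algebra_gen mu A.
  by rewrite -g_sigma_completed_algebra_genE completed_caratheodory_measurable.
move=> [B mB [N [M [mM M0 NM]]] BNA].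
exists B, M; split => //; first by rewrite -BNA; exact: subsetUl.
by rewrite -BNA; exact: setUS.
Qed.

Lemma ae_lebesgue_null (P : R -> Prop) :
  {ae @completed_lebesgue_measure R, forall x : R, P x} ->
  exists N : set R, [/\ measurable N, mu N = 0%E & forall x, ~ N x -> P x].
Proof.
move=> [A [mA A0 PA]].
have [B [N [mB N0 mN BA ABN]]] := lebesgue_measurable_decomp mA.
have B0 : mu B = 0%E.
  apply/eqP; rewrite eq_le measure_ge0 andbT -A0.
  exact: le_outer_measure.
exists (B `|` N); split; first exact: measurableU.
  by rewrite (measureU0 (mu := mu)).
move=> x nBN; apply: contrapT => nP; apply: nBN; apply: ABN; exact: PA.
Qed.

Lemma lebesgue_measurable_supp (f : R -> R[i]) : lebesgue_measurable_fun f ->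
  measurable (supp f : set (lebesgueType R)).
Proof.
move=> mf; have -> : supp f = [set: lebesgueType R] `&` f @^-1` (~` [set 0]).
  by rewrite setTI; apply/seteqP; split=> x /=; rewrite /supp /= => /eqP.
apply: mf => //; apply: sub_sigma_algebra.
apply: (@closed_openC (R[i]^o)).
apply: (@accessible_closed_set1 (R[i]^o)); apply: hausdorff_accessible.
exact: (@norm_hausdorff _ (R[i]^o)).
Qed.

(** The partial sums are constant once the index set contains [A], and limits along the net are
    unique. *)
Lemma sums_to_finite (u : int -> R[i]) (s : R[i]) (A : {fset int}) :
  (forall k, k \notin A -> u k = 0) -> sums_to u s ->
  \sum_(k <- A) u k = s.
Proof.
move=> u0 us.
have totally_filter := @summability.totally_filter int.
have A_lim : summability.partial_sum u @ summability.totally -->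
    (\sum_(k <- A) u k : R[i]^o).
  apply: (@cvg_near_cst _ (R[i]^o) _ (summability.partial_sum u)
    (@summability.totally int) _).
  exists A => // B /= AB.
  rewrite /summability.partial_sum -(big_seq_fsetE _ _ xpredT u) /=.
  by apply/esym; apply: big_fset_incl => // k _ /u0.
apply: (@cvg_unique (R[i]^o) (@norm_hausdorff _ (R[i]^o)) _ _ _ _ A_lim us).
Qed.

End lebesgue_measurable.

(** * Sums of [f] over finite components, and application to its support *)

(** Through an edge of the component, the series along [gam b] is a finite sum: any point of that
    coset where [f] is nonzero is an edge on the same vertex, hence in the component. Each
    [b]-vertex thus contributes [n]. *)
Lemma component_sum (R : realType) (gam : bool -> R) (S : set R)
    (f : R -> R[i]) (n : nat) b (y : R) :
    (forall g, f (y + tau gam g) != 0 -> edges gam S y g) ->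
    (forall g, sums_to (fun k : int => f (y + tau gam g - k%:~R * gam b)) n%:R) ->
    finite_set (component label (edges gam S y) 0) ->
  \sum_(h <- fset_set (component label (edges gam S y) 0)) f (y + tau gam h) =
  (n * #|` [fset label b g | g in
     fset_set (component label (edges gam S y) 0)]%fset|)%:R.
Proof.
move=> fS fsum finC; set C := fset_set _.
have inC g : (g \in C) <-> component label (edges gam S y) 0 g.
  by rewrite in_fset_set// inE.
rewrite natrM mulr_natr.
apply: component_vertex_sum => // g yg.
pose D : {fset int * int} := [fset h in C | label b h == label b g]%fset.
(* [step h] is the index of the term of the series attached to the edge [h]. *)
pose step (h : int * int) := label (~~ b) g - label (~~ b) h.
have stepK h : label b h = label b g -> h = g + dir b (- step h).
  move=> lh; rewrite [LHS](dirK b) lh [in RHS](dirK b g) /step opprB.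
  rewrite addrAC; congr (_ + _); case: (b) => /=; apply/eqP;
  by rewrite xpair_eqE /= ?addr0 ?eqxx ?andbT //= addrC subrK.
have inD h : (h \in D) = (h \in C) && (label b h == label b g).
  by rewrite !inE.
have step_inj : {in D &, injective step}.
  move=> h h'; rewrite !inD => /andP[_ /eqP lh] /andP[_ /eqP lh'] hh'.
  by rewrite (stepK h lh) (stepK h' lh') hh'.
have stepE k : y + tau gam g - k%:~R * gam b = y + tau gam (g + dir b (- k)).
  by rewrite tauD (tau_dir gam b) intrN mulNr -addrA.
have := @sums_to_finite R _ _ [fset step h | h in D]%fset _ (fsum g).
rewrite big_imfset//= => <-.
  rewrite -big_fset_condE; apply: eq_bigr => h /eqP lh.
  by rewrite stepE -stepK.
move=> k kD; apply: contraNeq kD; rewrite stepE => /fS Gk.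
have lk : label b (g + dir b (- k)) = label b g.
  by rewrite labelD label_dir addr0.
apply/imfsetP; exists (g + dir b (- k)) => /=.
  rewrite inD lk eqxx andbT; apply/inC; exact: conn_rcons yg Gk (esym lk).
by rewrite /step labelD; case: (b); rewrite /= ?opprD ?opprK addrA subrr add0r.
Qed.

Theorem theorem2p6 (R : realType) (alpha beta : R) (p q : nat) (f : R -> R[i])
  (alpha_gt0 : 0 < alpha) (beta_gt0 : 0 < beta)
  (indep : rationally_independent alpha beta)
  (p_gt0 : (0 < p)%N) (q_gt0 : (0 < q)%N) (coprime_pq : coprime p q)
  (mf : lebesgue_measurable_fun f)
  (abs_alpha : {ae completed_lebesgue_measure, forall x : R,
     abs_convergent (fun k : int => f (x - k%:~R * alpha))})
  (abs_beta : {ae completed_lebesgue_measure, forall x : R,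
     abs_convergent (fun k : int => f (x - k%:~R * beta))})
  (sum_alpha : {ae completed_lebesgue_measure, forall x : R,
     sums_to (fun k : int => f (x - k%:~R * alpha)) p%:R})
  (sum_beta : {ae completed_lebesgue_measure, forall x : R,
     sums_to (fun k : int => f (x - k%:~R * beta)) q%:R}) :
  ((alpha + beta - Num.min (alpha / q%:R) (beta / p%:R))%:E <
     completed_lebesgue_measure (supp f))%E.
Proof.
pose gam b := if b then alpha else beta.
pose lev b := if b then p else q.
have gam_gt0 b : 0 < gam b by case: b.
have lev_gt0 b : (0 < lev b)%N by case: b.
have [B [N [mB N0 mN Bf fBN]]] :=
  lebesgue_measurable_decomp (lebesgue_measurable_supp mf).
have [Z Zsum] : exists Z : bool -> set R, forall b, [/\ measurable (Z b),
    lebesgue_measure (Z b) = 0%E & forall x, ~ Z b x ->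
    sums_to (fun k : int => f (x - k%:~R * gam b)) (lev b)%:R].
  have [Za Zap] := ae_lebesgue_null sum_alpha.
  have [Zb Zbp] := ae_lebesgue_null sum_beta.
  by exists (fun b => if b then Za else Zb); case.
(* Outside [W], which is null and invariant under translations by [alpha] and
   [beta], every point of the orbit is good. *)
pose W0 : set R := N `|` (Z true `|` Z false).
pose W : set R := [set x | exists g, W0 (x + tau gam g)].
have mZ : measurable (Z true `|` Z false).
  by apply: measurableU; [case: (Zsum true)|case: (Zsum false)].
have mW0 : measurable W0 by exact: measurableU.
have mW0g g : measurable [set x | W0 (x + tau gam g)].
  exact: measurable_tau.
have mW : measurable W by exact: measurable_exists.
have W00 : lebesgue_measure W0 = 0%E.
  have [mt t0 _] := Zsum true; have [mf' f0 _] := Zsum false.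
  by rewrite (measureU0 (mu := lebesgue_measure))//
    (measureU0 (mu := lebesgue_measure)).
have W_0 : lebesgue_measure W = 0%E.
  by apply: measure0_exists => // g; rewrite lebesgue_measure_translate.
have W_tau x g : ~ W x -> ~ W (x + tau gam g).
  by move=> nW [h]; rewrite -addrA -tauD => Wgh; apply: nW; exists (g + h).
have W_W0 x : ~ W x -> ~ W0 x.
  by move=> nW W0x; apply: nW; exists 0; rewrite tau0 addr0.
(* [S] is a Borel set inside the support which, off the null set [W], contains every point where [f]
   is nonzero. *)
pose S := B `\` W.
have mS : measurable S by exact: measurableD.
have fS x : ~ W x -> f x != 0 -> S x.
  move=> nW fx; split => //; have [//|Nx] := fBN x fx.
  by exfalso; apply: (W_W0 x nW); left.
have fsum b x : ~ W x -> sums_to (fun k : int => f (x - k%:~R * gam b)) (lev b)%:R.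
  move=> nW; have [_ _] := Zsum b; apply => Zx; apply: (W_W0 x nW); right.
  by case: b Zx; [left|right].
apply: (@lt_le_trans _ _ (lebesgue_measure S)); last first.
  by apply: le_outer_measure => x [/Bf].
apply: (@measure_gt R gam gam_gt0 indep S mS _ lev lev_gt0 coprime_pq) => [b|y Sy fy].
- apply/eqP; rewrite eq_le measure_ge0 andbT -W_0.
  have mcov : measurable [set x | exists k, S (x + tau gam (dir b k))].
    by apply: measurable_exists => k; exact: measurable_tau.
  apply: le_measure; rewrite ?inE//.
    by apply: measurableD => //; exact: measurable_cell.
  (* If the coset of a good point missed [S], then [f] would vanish along it and its sum would be 0
     instead of the positive [lev b]. *)
  move=> x [cx ncov]; apply: contrapT => nW.
  have f0 k : k \notin fset0 -> f (x - k%:~R * gam b) = 0.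
    move=> _; apply: contrapT => /eqP fk; apply: ncov; exists (- k).
    have xk : x - k%:~R * gam b = x + tau gam (dir b (- k)).
      by rewrite (tau_dir gam b) intrN mulNr.
    by rewrite xk in fk; apply: fS => //; exact: W_tau.
  have := sums_to_finite f0 (fsum b x nW); rewrite big_seq_fset0 => /esym/eqP.
  by rewrite pnatr_eq0 eqn0Ngt lev_gt0.
- have nW : ~ W y by case: Sy.
  (* For each [b], the sum of [f] over the component is [lev b] times the number of its
     [b]-vertices; the two values are compared in [R[i]]. *)
  have sumE b := @component_sum R gam S f (lev b) b y
    (fun g => fS _ (W_tau y g nW)) (fun g => fsum b _ (W_tau y g nW)) fy.
  by apply/eqP; rewrite -(eqr_nat R[i]) -sumE -sumE.
Qed.
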